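(* Let $\mathscr{C}$ be a fiat 2-category, $\mathcal{L}$ a left cell in $\mathscr{C}$, and $G\in\mathcal{L}$. Then $G$ is great for $\mathcal{L}$ if and only if $G$ is the Duflo 1-morphism of $\mathcal{L}$.
   Context: $\Bbbk$ is an algebraically closed field of characteristic $0$. A finitary 2-category $\mathscr{C}$ (over $\Bbbk$) is a 2-category with finitely many objects such that each $\mathscr{C}(\mathtt{i},\mathtt{j})$ is an additive, idempotent split, $\Bbbk$-linear category with finite dimensional morphism spaces and finitely many isomorphism classes of indecomposable objects, horizontal composition is biadditive and $\Bbbk$-bilinear, and each identity 1-morphism $\mathbbm{1}_\mathtt{i}$ is indecomposable. It is fiat if it has a weak involution $\star$ (reversing the directions of both 1- and 2-morphisms) such that each pair $(F,F^\star)$ of 1-morphisms is an adjoint pair via some choice of adjunction 2-morphisms between the compositions $FF^\star$, $F^\star F$ and the relevant identities. Vertical composition of 2-morphisms is denoted $\circ_v$. For indecomposable 1-morphisms (up to isomorphism) write $F\leq_L G$ if $G$ is a direct summand of $H\circ F$ for some $H$; left cells are the equivalence classes of the induced equivalence relation. For a left cell $\mathcal{L}$ let $\mathtt{i}=\mathtt{i}_\mathcal{L}$ be the object at which all 1-morphisms in $\mathcal{L}$ start. Let $\mathbf{P}_\mathtt{i}=\mathscr{C}(\mathtt{i},-)$ be the principal 2-representation and $\overline{\mathbf{P}}_\mathtt{i}$ its projective abelianization: up to equivalence, objects of $\overline{\mathbf{P}}_\mathtt{i}(\mathtt{j})$ are 2-morphisms $X\to Y$ in $\mathscr{C}(\mathtt{i},\mathtt{j})$,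 morphisms are commutative squares modulo those for which the map on the $Y$-components factors through the $X$-component of the target (homotopy), and 1-morphisms of $\mathscr{C}$ act componentwise. This is an abelian category whose indecomposable projectives are $P_G:=(0\to G)$ for indecomposable 1-morphisms $G$. Duflo 1-morphism: $G\in\mathcal{L}$ is a Duflo 1-morphism for $\mathcal{L}$ if the projective $P_{\mathbbm{1}_\mathtt{i}}\in\overline{\mathbf{P}}_\mathtt{i}(\mathtt{i})$ has a subobject $K$ such that (1) $P_{\mathbbm{1}_\mathtt{i}}/K$ is annihilated by all $F\in\mathcal{L}$, and (2) there is a surjective morphism $P_G\to K$. It is known that every left cell in a fiat 2-category has a unique Duflo 1-morphism. Good and great: a 1-morphism $G$ is good for $\mathcal{L}$ (via $\varphi$) if there is a 2-morphism $\varphi:G\to\mathbbm{1}_\mathtt{i}$ such that for every $F\in\mathcal{L}$ the 2-morphism $F\varphi:FG\to F$ is right split, i.e. there is $\xi:F\to FG$ with $F\varphi\circ_v\xi=\mathrm{id}_F$. $G$ is great for $\mathcal{L}$ if it is good for $\mathcal{L}$ via some $\varphi$ and, for any $G'$ which is good for $\mathcal{L}$ via $\varphi':G'\to\mathbbm{1}_\mathtt{i}$, there is a 2-morphism $\beta:G\to G'$ with $\varphi=\varphi'\circ_v\beta$. *)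

(* Defs.v *)
(* Finitary and fiat 2-categories, left cells, Duflo 1-morphisms, and good and
   great 1-morphisms (written over MathComp).
   Composition is written in applicative order: for F : mor1 i j and
   G : mor1 j l, G \o1 F : mor1 i l. *)
From HB Require Import structures.
From mathcomp Require Import all_boot all_algebra.

Set Implicit Arguments.
Unset Strict Implicit.
Unset Printing Implicit Defensive.

Import GRing.Theory.
Local Open Scope ring_scope.

(** * Hom-finite k-linear 2-categories *)

(* The spaces of 2-morphisms are finite dimensional because they are of type
   [vectType k], and there are finitely many objects because [obj] is a
   [finType]. *)
Record pre2cat (k : fieldType) := Pre2Cat {
  obj : finType;
  mor1 : obj -> obj -> Type;
  hom2 : forall i j, mor1 i j -> mor1 i j -> vectType k;
  id1 : forall i, mor1 i i;
  comp1 : forall i j l, mor1 j l -> mor1 i j -> mor1 i l;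
  id2 : forall i j (F : mor1 i j), hom2 F F;
  vcomp : forall i j (F G H : mor1 i j), hom2 G H -> hom2 F G -> hom2 F H;
  hcomp : forall i j l (F F' : mor1 i j) (G G' : mor1 j l),
    hom2 G G' -> hom2 F F' -> hom2 (comp1 G F) (comp1 G' F')
}.

Arguments mor1 {k p} i j.
Arguments hom2 {k p i j} F G.
Arguments id1 {k p} i.
Arguments comp1 {k p i j l} G F.
Arguments id2 {k p i j} F.
Arguments vcomp {k p i j F G H} b a.
Arguments hcomp {k p i j l F F' G G'} b a.

Notation "G \o1 F" := (comp1 G F) (at level 40, left associativity).
Notation "b \ov a" := (vcomp b a) (at level 40, left associativity).
Notation "b \oh a" := (hcomp b a) (at level 40, left associativity).

(* The identity 2-morphism of F, seen as a 2-morphism to any 1-morphism equal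
   to F.  The 2-categories below are strict, and [eq2] makes composites such as
   F \o1 id1 i and F, which are equal but not convertible, fit together. *)
Definition eq2 {k} {C : pre2cat k} {i j : obj C} {F G : mor1 i j} (e : F = G) :
    hom2 F G :=
  match e in _ = G0 return hom2 F G0 with erefl => id2 F end.

Record lin2cat (k : fieldType) := Lin2Cat {
  pre2cat_of :> pre2cat k;
  comp1A : forall (a b c d : obj pre2cat_of)
      (H : mor1 c d) (G : mor1 b c) (F : mor1 a b),
    H \o1 (G \o1 F) = (H \o1 G) \o1 F;
  comp1_idl : forall (i j : obj pre2cat_of) (F : mor1 i j), id1 j \o1 F = F;
  comp1_idr : forall (i j : obj pre2cat_of) (F : mor1 i j), F \o1 id1 i = F;
  vcompA : forall (i j : obj pre2cat_of) (E F G H : mor1 i j)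
      (c : hom2 G H) (b : hom2 F G) (a : hom2 E F),
    c \ov (b \ov a) = (c \ov b) \ov a;
  vcomp_idl : forall (i j : obj pre2cat_of) (F G : mor1 i j) (a : hom2 F G),
    id2 G \ov a = a;
  vcomp_idr : forall (i j : obj pre2cat_of) (F G : mor1 i j) (a : hom2 F G),
    a \ov id2 F = a;
  vcomp_linl : forall (i j : obj pre2cat_of) (F G H : mor1 i j) (a : hom2 F G),
    linear (fun b : hom2 G H => b \ov a);
  vcomp_linr : forall (i j : obj pre2cat_of) (F G H : mor1 i j) (b : hom2 G H),
    linear (fun a : hom2 F G => b \ov a);
  hcomp_id : forall (i j l : obj pre2cat_of) (G : mor1 j l) (F : mor1 i j),
    id2 G \oh id2 F = id2 (G \o1 F);
  interchange : forall (i j l : obj pre2cat_of)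
      (F F' F'' : mor1 i j) (G G' G'' : mor1 j l)
      (b' : hom2 G' G'') (b : hom2 G G') (a' : hom2 F' F'') (a : hom2 F F'),
    (b' \ov b) \oh (a' \ov a) = (b' \oh a') \ov (b \oh a);
  hcomp_linl : forall (i j l : obj pre2cat_of)
      (F F' : mor1 i j) (G G' : mor1 j l) (a : hom2 F F'),
    linear (fun b : hom2 G G' => b \oh a);
  hcomp_linr : forall (i j l : obj pre2cat_of)
      (F F' : mor1 i j) (G G' : mor1 j l) (b : hom2 G G'),
    linear (fun a : hom2 F F' => b \oh a);
  hcompA : forall (i1 i2 i3 i4 : obj pre2cat_of)
      (F F' : mor1 i1 i2) (G G' : mor1 i2 i3) (H H' : mor1 i3 i4)
      (c : hom2 H H') (b : hom2 G G') (a : hom2 F F'),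
    eq2 (comp1A H' G' F') \ov (c \oh (b \oh a)) =
    ((c \oh b) \oh a) \ov eq2 (comp1A H G F);
  hcomp_idl : forall (i j : obj pre2cat_of) (F F' : mor1 i j) (a : hom2 F F'),
    eq2 (comp1_idl F') \ov (id2 (id1 j) \oh a) = a \ov eq2 (comp1_idl F);
  hcomp_idr : forall (i j : obj pre2cat_of) (F F' : mor1 i j) (a : hom2 F F'),
    eq2 (comp1_idr F') \ov (a \oh id2 (id1 i)) = a \ov eq2 (comp1_idr F)
}.

(** * Additive notions in the categories C(i, j) *)

Section Additive.
Context {k : fieldType} {C : lin2cat k} {i j : obj C}.

Definition is_iso2 (F G : mor1 i j) (a : hom2 F G) : Prop :=
  exists b : hom2 G F, b \ov a = id2 F /\ a \ov b = id2 G.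

Definition iso1 (F G : mor1 i j) : Prop := exists a : hom2 F G, is_iso2 a.

Definition is_zero1 (F : mor1 i j) : Prop :=
  forall G : mor1 i j,
    (forall a : hom2 F G, a = 0) /\ (forall a : hom2 G F, a = 0).

Definition is_biproduct (A B S : mor1 i j) : Prop :=
  exists (iA : hom2 A S) (iB : hom2 B S) (pA : hom2 S A) (pB : hom2 S B),
    [/\ pA \ov iA = id2 A, pB \ov iB = id2 B, pA \ov iB = 0, pB \ov iA = 0
      & iA \ov pA + iB \ov pB = id2 S].

Definition direct_summand (F G : mor1 i j) : Prop :=
  exists F' : mor1 i j, is_biproduct F F' G.

Definition indecomposable (F : mor1 i j) : Prop :=
  ~ is_zero1 F /\
  forall A B : mor1 i j, is_biproduct A B F -> is_zero1 A \/ is_zero1 B.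

End Additive.

(** * Finitary 2-categories *)

Record finitary2cat (k : fieldType) := Finitary2Cat {
  lin2cat_of :> lin2cat k;
  zero1 : forall i j : obj lin2cat_of, mor1 i j;
  zero1P : forall i j : obj lin2cat_of, is_zero1 (zero1 i j);
  biproduct_ex : forall (i j : obj lin2cat_of) (A B : mor1 i j),
    exists S : mor1 i j, is_biproduct A B S;
  idempotent_split : forall (i j : obj lin2cat_of) (F : mor1 i j) (e : hom2 F F),
    e \ov e = e ->
    exists (G : mor1 i j) (p : hom2 F G) (s : hom2 G F),
      p \ov s = id2 G /\ s \ov p = e;
  finite_indec : forall i j : obj lin2cat_of,
    exists (n : nat) (D : 'I_n -> mor1 i j),
      forall F : mor1 i j, indecomposable F -> exists a : 'I_n, iso1 F (D a);
  id1_indec : forall i : obj lin2cat_of, indecomposable (id1 i)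
}.

Arguments zero1 {k f} i j.

(** * Fiat 2-categories *)

(* A weak 2-functor star from C to the 2-category obtained from C by reversing
   1- and 2-morphisms, with constraints [starM] and [starU], together with an
   isomorphism [starK] from the identity to the square of star which is natural
   and compatible with these constraints.  It is the identity on objects: this
   is forced by the adjunctions in [fiat], as i and the image of i have to agree
   for id1 i and its image to be composable.  Nothing is asked about star2 and
   scalars (its additivity is automatic). *)
Record weak_involution (k : fieldType) (C : lin2cat k) := WeakInvolution {
  star1 : forall i j : obj C, mor1 i j -> mor1 j i;
  star2 : forall (i j : obj C) (F G : mor1 i j),
    hom2 F G -> hom2 (star1 G) (star1 F);
  star2_id : forall (i j : obj C) (F : mor1 i j),
    star2 (id2 F) = id2 (star1 F);
  star2_comp : forall (i j : obj C) (F G H : mor1 i j)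
      (b : hom2 G H) (a : hom2 F G),
    star2 (b \ov a) = star2 a \ov star2 b;
  starM : forall (i j l : obj C) (G : mor1 j l) (F : mor1 i j),
    hom2 (star1 F \o1 star1 G) (star1 (G \o1 F));
  starM_iso : forall (i j l : obj C) (G : mor1 j l) (F : mor1 i j),
    is_iso2 (starM G F);
  starM_nat : forall (i j l : obj C) (G G' : mor1 j l) (F F' : mor1 i j)
      (b : hom2 G G') (a : hom2 F F'),
    starM G F \ov (star2 a \oh star2 b) = star2 (b \oh a) \ov starM G' F';
  starU : forall i : obj C, hom2 (id1 i) (star1 (id1 i));
  starU_iso : forall i : obj C, is_iso2 (starU i);
  starM_assoc : forall (a b c d : obj C)
      (H : mor1 c d) (G : mor1 b c) (F : mor1 a b),
    star2 (eq2 (comp1A H G F)) \ov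
      (starM (H \o1 G) F \ov (id2 (star1 F) \oh starM H G)) =
    starM H (G \o1 F) \ov
      ((starM G F \oh id2 (star1 H)) \ov
        eq2 (comp1A (star1 F) (star1 G) (star1 H)));
  starU_l : forall (i j : obj C) (F : mor1 i j),
    starM F (id1 i) \ov (starU i \oh id2 (star1 F)) =
    star2 (eq2 (comp1_idr F)) \ov eq2 (comp1_idl (star1 F));
  starU_r : forall (i j : obj C) (F : mor1 i j),
    starM (id1 j) F \ov (id2 (star1 F) \oh starU j) =
    star2 (eq2 (comp1_idl F)) \ov eq2 (comp1_idr (star1 F));
  starK : forall (i j : obj C) (F : mor1 i j), hom2 F (star1 (star1 F));
  starK_iso : forall (i j : obj C) (F : mor1 i j), is_iso2 (starK F);
  starK_nat : forall (i j : obj C) (F F' : mor1 i j) (a : hom2 F F'),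
    starK F' \ov a = star2 (star2 a) \ov starK F;
  starK_comp : forall (i j l : obj C) (G : mor1 j l) (F : mor1 i j),
    star2 (starM G F) \ov starK (G \o1 F) =
    starM (star1 F) (star1 G) \ov (starK G \oh starK F);
  starK_id : forall i : obj C, star2 (starU i) \ov starK (id1 i) = starU i
}.

Definition adjoint_pair {k} {C : lin2cat k} {i j : obj C}
    (F : mor1 i j) (F' : mor1 j i) : Prop :=
  exists (counit : hom2 (F \o1 F') (id1 j)) (unit : hom2 (id1 i) (F' \o1 F)),
    eq2 (comp1_idl F) \ov ((counit \oh id2 F) \ov
      (eq2 (comp1A F F' F) \ov (id2 F \oh unit))) = eq2 (comp1_idr F) /\
    eq2 (comp1_idr F') \ov ((id2 F' \oh counit) \ov
      (eq2 (esym (comp1A F' F F')) \ov (unit \oh id2 F'))) = eq2 (comp1_idl F').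

Definition fiat {k} (C : finitary2cat k) : Prop :=
  exists S : weak_involution C,
    forall (i j : obj C) (F : mor1 i j), adjoint_pair F (star1 S F).

(** * Left cells *)

Definition leL {k} {C : lin2cat k} {i j l : obj C}
    (F : mor1 i j) (G : mor1 i l) : Prop :=
  exists H : mor1 j l, direct_summand G (H \o1 F).

(* 1-morphisms related by [leL] have the same source, so a left cell is a family
   of predicates on the 1-morphisms starting at a fixed object i.  It is
   automatically closed under isomorphism. *)
Definition left_cell {k} {C : lin2cat k} {i : obj C}
    (L : forall j : obj C, mor1 i j -> Prop) : Prop :=
  exists (j0 : obj C) (F0 : mor1 i j0), indecomposable F0 /\
    forall (j : obj C) (F : mor1 i j),
      L j F <-> [/\ indecomposable F, leL F0 F & leL F F0].

(** * The projective abelianization of the principal 2-representation at i *)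

Section Abelianization.
Context {k : fieldType} {C : lin2cat k} {i : obj C}.

Record pobj (j : obj C) := PObj {
  pX : mor1 i j;
  pY : mor1 i j;
  pmap : hom2 pX pY
}.

(* Representatives of morphisms; two of them are the same morphism when they are
   related by [peq].  All categorical notions below are up to [peq]. *)
Record psquare (j : obj C) (A B : pobj j) := PSquare {
  sqX : hom2 (pX A) (pX B);
  sqY : hom2 (pY A) (pY B);
  sq_comm : sqY \ov pmap A = pmap B \ov sqX
}.

Definition pnull (j : obj C) (A B : pobj j) (f : psquare A B) : Prop :=
  exists h : hom2 (pY A) (pX B), sqY f = pmap B \ov h.

Definition peq (j : obj C) (A B : pobj j) (f g : psquare A B) : Prop :=
  exists h : hom2 (pY A) (pX B), sqY f - sqY g = pmap B \ov h.

Lemma pcomp_comm (j : obj C) (A B D : pobj j)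
    (g : psquare B D) (f : psquare A B) :
  (sqY g \ov sqY f) \ov pmap A = pmap D \ov (sqX g \ov sqX f).
Proof. by rewrite -vcompA sq_comm vcompA sq_comm vcompA. Qed.

Definition pcomp (j : obj C) (A B D : pobj j)
    (g : psquare B D) (f : psquare A B) : psquare A D :=
  PSquare (pcomp_comm g f).

Definition pmono (j : obj C) (A B : pobj j) (m : psquare A B) : Prop :=
  forall (T : pobj j) (u v : psquare T A),
    peq (pcomp m u) (pcomp m v) -> peq u v.

Definition pepi (j : obj C) (A B : pobj j) (e : psquare A B) : Prop :=
  forall (T : pobj j) (u v : psquare B T),
    peq (pcomp u e) (pcomp v e) -> peq u v.

Definition pcokernel (j : obj C) (A B Q : pobj j)
    (m : psquare A B) (q : psquare B Q) : Prop :=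
  pnull (pcomp q m) /\
  forall (T : pobj j) (t : psquare B T), pnull (pcomp t m) ->
    (exists u : psquare Q T, peq (pcomp u q) t) /\
    (forall u v : psquare Q T,
       peq (pcomp u q) t -> peq (pcomp v q) t -> peq u v).

Definition pzero (j : obj C) (A : pobj j) : Prop :=
  forall B : pobj j,
    (forall f : psquare A B, pnull f) /\ (forall f : psquare B A, pnull f).

Definition paction (j l : obj C) (F : mor1 j l) (A : pobj j) : pobj l :=
  PObj (id2 F \oh pmap A).

End Abelianization.

Definition pproj {k} {C : finitary2cat k} {i j : obj C} (G : mor1 i j) :
    pobj (i := i) j :=
  PObj (0 : hom2 (zero1 i j) G).

(** * Duflo, good and great 1-morphisms *)

Section Duflo.
Context {k : fieldType} {C : finitary2cat k} {i : obj C}.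
Variable L : forall j : obj C, mor1 i j -> Prop.

(* A subobject is given by a monomorphism, and the quotient by its cokernel. *)
Definition duflo (G : mor1 i i) : Prop :=
  L G /\
  exists (K : pobj i) (m : psquare K (pproj (id1 i))),
    [/\ pmono m,
        exists (Q : pobj i) (q : psquare (pproj (id1 i)) Q),
          pcokernel m q /\
          forall (j : obj C) (F : mor1 i j), L F -> pzero (paction F Q)
      & exists p : psquare (pproj G) K, pepi p].

Definition good_via (G : mor1 i i) (phi : hom2 G (id1 i)) : Prop :=
  forall (j : obj C) (F : mor1 i j), L F ->
    exists xi : hom2 F (F \o1 G),
      (eq2 (comp1_idr F) \ov (id2 F \oh phi)) \ov xi = id2 F.

Definition great (G : mor1 i i) : Prop :=
  exists phi : hom2 G (id1 i),
    good_via phi /\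
    forall (G' : mor1 i i) (phi' : hom2 G' (id1 i)), good_via phi' ->
      exists beta : hom2 G G', phi = phi' \ov beta.

End Duflo.

(* Main.v *)
Require Import Defs.
From HB Require Import structures.
From mathcomp Require Import all_boot all_algebra.
From Stdlib Require Import Classical.
Import GRing.Theory.
Local Open Scope ring_scope.

(** Both sides of the equivalence amount to the existence of a 2-morphism
    phi : G -> 1 via which G is good for the left cell.

    Good and Duflo.  The object phi : G -> 1 of the projective abelianization
    is the cokernel of P_G -> P_1, and F sends it to F phi : FG -> F.  An object
    X -> Y is zero exactly when X -> Y is split surjective ([pzero_split]), so
    G is good via phi if and only if the cokernel of phi is annihilated by the
    left cell ([good_viaE]).  If G is good via phi, the subobject K required of
    a Duflo 1-morphism is the image of phi ([good_duflo]).  It is represented by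
    X -> G, where X -> G is a weak kernel of phi; weak kernels exist because
    C(i, j) is hom-finite and Krull-Schmidt with finitely many indecomposables
    ([weak_kernel]).  Conversely, if K is a subobject of P_1 covered by P_G, the
    composite P_G -> K -> P_1 is given by some phi : G -> 1, whose cokernel is
    P_1 / K, and is therefore annihilated by the left cell ([duflo_good]).

    Good and great.  Let G be in the left cell, let phi : G -> 1 be arbitrary
    and let G' be good via phi'.  The two ways to evaluate phi next to phi'
    agree:
      phi o (G phi') = phi' o (phi G') : GG' -> 1.
    Since G phi' has a section, phi factors through phi' ([good_factors]).  So a
    1-morphism of the left cell that is good is automatically great. *)

(** * Linearity of the compositions *)

Section Linearity.
Context {k : fieldType} {C : lin2cat k}.

Section Vertical.
Context {i j : obj C} {F G H : mor1 i j}.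
Implicit Types (a : hom2 F G) (b : hom2 G H).

Lemma vcompDl b b' a : (b + b') \ov a = b \ov a + b' \ov a.
Proof. by have := vcomp_linl a 1 b b'; rewrite !scale1r. Qed.

Lemma vcompDr b a a' : b \ov (a + a') = b \ov a + b \ov a'.
Proof. by have := vcomp_linr b 1 a a'; rewrite !scale1r. Qed.

Lemma vcomp0l a : (0 : hom2 G H) \ov a = 0.
Proof. by apply: (addIr (0 \ov a)); rewrite -vcompDl !add0r. Qed.

Lemma vcomp0r b : b \ov (0 : hom2 F G) = 0.
Proof. by apply: (addIr (b \ov 0)); rewrite -vcompDr !add0r. Qed.

Lemma vcompBr b a a' : b \ov (a - a') = b \ov a - b \ov a'.
Proof.
by have := vcomp_linr b (-1) a' a; rewrite !scaleN1r ![- _ + _]addrC.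
Qed.

End Vertical.

Lemma whiskerB {i j l : obj C} (F : mor1 j l) {G H : mor1 i j}
    (a b : hom2 G H) :
  id2 F \oh (a - b) = id2 F \oh a - id2 F \oh b.
Proof.
by have := hcomp_linr (id2 F) (-1) b a; rewrite !scaleN1r ![- _ + _]addrC.
Qed.

Lemma whisker_vcomp {i j l : obj C} (F : mor1 j l) {G H E : mor1 i j}
    (b : hom2 H E) (a : hom2 G H) :
  id2 F \oh (b \ov a) = (id2 F \oh b) \ov (id2 F \oh a).
Proof. by rewrite -Defs.interchange vcomp_idl. Qed.

Lemma eq2_symK {i j : obj C} {F G : mor1 i j} (e : F = G) :
  eq2 e \ov eq2 (esym e) = id2 G.
Proof. by case: G / e; rewrite vcomp_idl. Qed.

Lemma eq2_Ksym {i j : obj C} {F G : mor1 i j} (e : F = G) :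
  eq2 (esym e) \ov eq2 e = id2 F.
Proof. by case: G / e; rewrite vcomp_idl. Qed.

Lemma zero_of_id2 {i j : obj C} (F : mor1 i j) : id2 F = 0 -> is_zero1 F.
Proof.
move=> F0 G; split=> a.
  by rewrite -[a]vcomp_idr F0 vcomp0r.
by rewrite -[a]vcomp_idl F0 vcomp0l.
Qed.

End Linearity.

(** * Decompositions into indecomposable 1-morphisms *)

Section Corner.
Context {k : fieldType} {C : lin2cat k} {i j : obj C} {A S : mor1 i j}.
Context (s : hom2 A S) (p : hom2 S A).

(** The embedding of End A as a corner of End S, for A a summand of S. *)
Definition corner (a : hom2 A A) : hom2 S S := s \ov a \ov p.

Lemma corner_linear : linear corner.
Proof.
by move=> c a b; rewrite /corner (vcomp_linr s c a b) (vcomp_linl p).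
Qed.

HB.instance Definition _ := GRing.isLinear.Build k _ _ _ corner corner_linear.

End Corner.

Section Decomposition.
Context {k : fieldType} {C : lin2cat k} {i j : obj C}.

(** If the dimensions agreed, every endomorphism of S, the identity included,
    would lie in the corner End A, which annihilates B. *)
Lemma dim_end_biproduct (A B S : mor1 i j) : is_biproduct A B S ->
  ~ is_zero1 B -> (\dim {: hom2 A A} < \dim {: hom2 S S})%N.
Proof.
case=> [sA [sB [pA [pB [psA psB psAB psBA _]]]]] nzB.
rewrite ltnNge; apply/negP => le_dim; apply: nzB; apply: zero_of_id2.
pose f := linfun (corner sA pA).
have fE a : f a = sA \ov a \ov pA by rewrite lfunE.
have inj_f : lker f == 0%VS.
  apply/lker0P => a b; rewrite !fE => eq_ab.
  have cornerK c : pA \ov (sA \ov c \ov pA) \ov sA = c.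
    by rewrite !vcompA psA vcomp_idl -vcompA psA vcomp_idr.
  by rewrite -[a]cornerK eq_ab cornerK.
have full_f : (limg f == fullv)%VS.
  by rewrite eqEdim subvf limg_dim_eq // (eqP inj_f) capv0.
have /memv_imgP [a _ idE] : id2 S \in limg f by rewrite (eqP full_f) memvf.
by rewrite -psB -[pB]vcomp_idr idE fE !vcompA psBA !vcomp0l.
Qed.

Lemma biproductC (A B S : mor1 i j) : is_biproduct A B S -> is_biproduct B A S.
Proof.
case=> [sA [sB [pA [pB [? ? ? ? e]]]]].
by exists sB, sA, pB, pA; split; rewrite // addrC.
Qed.

(** The Krull-Schmidt decomposition as an induction principle, by induction on
    the dimension of the endomorphism algebra. *)
Lemma indecomposable_ind (P : mor1 i j -> Prop) :
  (forall F, is_zero1 F -> P F) ->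
  (forall F, indecomposable F -> P F) ->
  (forall A B S, is_biproduct A B S -> P A -> P B -> P S) ->
  forall F, P F.
Proof.
move=> P0 Pindec Psum F.
have [n] := ubnP (\dim {: hom2 F F}).
elim: n F => // n IHn F leFn.
case: (classic (is_zero1 F)) => [/P0 //|nzF].
case: (classic (indecomposable F)) => [/Pindec //|decF].
suff [A [B [sumAB [nzA nzB]]]] :
    exists A B, is_biproduct A B F /\ ~ is_zero1 A /\ ~ is_zero1 B.
  apply: (Psum _ _ _ sumAB); apply: IHn; apply: leq_trans (leFn : (_ <= n)%N).
    exact: dim_end_biproduct sumAB nzB.
  exact: dim_end_biproduct (biproductC _ _ _ sumAB) nzA.
apply: NNPP => none; apply: decF; split=> // A B sumAB.
apply: NNPP => /not_or_and [nzA nzB].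
by apply: none; exists A, B.
Qed.

End Decomposition.

(** * Weak kernels *)

Definition factors_through {k : fieldType} {C : lin2cat k} {i j : obj C}
    {F X G : mor1 i j} (kappa : hom2 X G) (a : hom2 F G) : Prop :=
  exists h : hom2 F X, a = kappa \ov h.

Section WeakKernel.
Context {k : fieldType} {C : finitary2cat k} {i j : obj C} {G E : mor1 i j}.
Context (phi : hom2 G E).

(** Morphisms killed by phi can be collected one at a time: the sum of two of
    them is again killed by phi and both factor through it. *)
Lemma weak_kernel_join (X Y : mor1 i j) (x : hom2 X G) (y : hom2 Y G) :
  phi \ov x = 0 -> phi \ov y = 0 ->
  exists (Z : mor1 i j) (z : hom2 Z G),
    [/\ phi \ov z = 0, factors_through z x & factors_through z y].
Proof.
move=> x0 y0.
have [Z [sX [sY [pX [pY [psX psY psXY psYX _]]]]]] := biproduct_ex X Y.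
exists Z, (x \ov pX + y \ov pY); split.
- by rewrite vcompDr !vcompA x0 y0 !vcomp0l addr0.
- by exists sX; rewrite vcompDl -!vcompA psX psYX vcomp_idr vcomp0r addr0.
by exists sY; rewrite vcompDl -!vcompA psY psXY vcomp_idr vcomp0r add0r.
Qed.

Lemma factors_trans (X Y F : mor1 i j) (x : hom2 X G) (y : hom2 Y G)
    (a : hom2 F G) :
  factors_through y x -> factors_through x a -> factors_through y a.
Proof. by case=> u -> [v ->]; exists (u \ov v); rewrite vcompA. Qed.

(** Hom-finiteness: a sum of copies of D, one for each element of a basis of
    the space of all D -> G killed by phi. *)
Lemma weak_kernel_at (D : mor1 i j) :
  exists (X : mor1 i j) (x : hom2 X G), phi \ov x = 0 /\
    forall a : hom2 D G, phi \ov a = 0 -> factors_through x a.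
Proof.
have lin_phi : linear (fun a : hom2 D G => phi \ov a).
  exact: vcomp_linr.
pose f := linfun (HB.pack_for {linear hom2 D G -> hom2 D E}
  (fun a : hom2 D G => phi \ov a)
  (GRing.isLinear.Build k _ _ _ (fun a : hom2 D G => phi \ov a) lin_phi)).
have fE a : f a = phi \ov a by rewrite lfunE.
have span_s (s : seq (hom2 D G)) : (forall a, a \in s -> phi \ov a = 0) ->
    exists (X : mor1 i j) (x : hom2 X G), phi \ov x = 0 /\
      forall a, a \in s -> factors_through x a.
  elim: s => [|b s IHs] s0.
    by exists (zero1 i j), 0; split; rewrite ?vcomp0r.
  have [|X [x [x0 xs]]] := IHs.
    by move=> a sa; apply: s0; rewrite inE sa orbT.
  have b0 : phi \ov b = 0 by apply: s0; rewrite inE eqxx.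
  have [Z [z [z0 zx zb]]] := weak_kernel_join _ _ _ _ x0 b0.
  exists Z, z; split=> // a; rewrite inE => /predU1P [-> //|sa].
  exact: factors_trans zx (xs _ sa).
have [|X [x [x0 xB]]] := span_s (vbasis (lker f)).
  by move=> a /vbasis_mem; rewrite memv_ker fE => /eqP.
exists X, x; split=> // a a0.
have ker_a : a \in lker f by rewrite memv_ker fE a0.
rewrite (coord_vbasis ker_a).
elim/big_ind: _ => [|_ _ [u ->] [v ->]|r _].
- by exists 0; rewrite vcomp0r.
- by exists (u + v); rewrite vcompDr.
have [|u ->] := xB (vbasis (lker f))`_r; first by rewrite mem_nth ?size_tuple.
exists (coord (vbasis (lker f)) r a *: u).
by have := vcomp_linr x (coord (vbasis (lker f)) r a) u 0;
  rewrite !addr0 vcomp0r addr0.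
Qed.

(** Factoring through x can be checked on indecomposable sources, and there
    are finitely many of these up to isomorphism. *)
Lemma weak_kernel :
  exists (X : mor1 i j) (x : hom2 X G), phi \ov x = 0 /\
    forall (F : mor1 i j) (a : hom2 F G), phi \ov a = 0 -> factors_through x a.
Proof.
have [n [D indecD]] := @finite_indec k C i j.
have [X [x [x0 xD]]] : exists (X : mor1 i j) (x : hom2 X G), phi \ov x = 0 /\
    forall r, r \in enum 'I_n ->
      forall a : hom2 (D r) G, phi \ov a = 0 -> factors_through x a.
  elim: (enum 'I_n) => [|r s [X [x [x0 xs]]]].
    by exists (zero1 i j), 0; split; rewrite ?vcomp0r.
  have [Y [y [y0 yr]]] := weak_kernel_at (D r).
  have [Z [z [z0 zx zy]]] := weak_kernel_join _ _ _ _ x0 y0.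
  exists Z, z; split=> // r'; rewrite inE => /predU1P [->|sr'] a a0.
    exact: factors_trans zy (yr _ a0).
  exact: factors_trans zx (xs _ sr' _ a0).
exists X, x; split=> // F.
elim/(@indecomposable_ind k C i j): F => [F F0|F indF|A B S sumAB xA xB] a a0.
- by exists 0; rewrite vcomp0r; have [aF0 _] := F0 G; apply: aF0.
- have [r [u [v [vu _]]]] := indecD _ indF.
  have [|h ah] := xD r (mem_enum _ _) (a \ov v).
    by rewrite vcompA a0 vcomp0l.
  by exists (h \ov u); rewrite vcompA -ah -vcompA vu vcomp_idr.
have [sA [sB [pA [pB [_ _ _ _ id_S]]]]] := sumAB.
have [|hA aA] := xA (a \ov sA); first by rewrite vcompA a0 vcomp0l.
have [|hB aB] := xB (a \ov sB); first by rewrite vcompA a0 vcomp0l.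
exists (hA \ov pA + hB \ov pB).
by rewrite vcompDr !vcompA -aA -aB -!vcompA -vcompDr id_S vcomp_idr.
Qed.

End WeakKernel.

(** * The projective abelianization *)

Section Abelianization.
Context {k : fieldType} {C : finitary2cat k} {i : obj C}.

Lemma pid_comm {j : obj C} (A : pobj (i := i) j) :
  id2 (pY A) \ov Defs.pmap A = Defs.pmap A \ov id2 (pX A).
Proof. by rewrite vcomp_idl vcomp_idr. Qed.

Definition pid {j : obj C} (A : pobj (i := i) j) : psquare A A :=
  PSquare (pid_comm A).

(** X -> Y represents its cokernel, which vanishes when X -> Y is surjective
    onto the projective Y, that is, split.  For the direct implication, the
    null-homotopy of the identity is the section. *)
Lemma pzero_split (j : obj C) (A : pobj (i := i) j) :
  pzero A <-> exists h : hom2 (pY A) (pX A), Defs.pmap A \ov h = id2 (pY A).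
Proof.
split=> [zeroA|[h hP] B].
  by have [/(_ (pid A)) [h hP] _] := zeroA A; exists h; rewrite -[LHS]hP.
split=> f.
  by exists (sqX f \ov h); rewrite vcompA -sq_comm -vcompA hP vcomp_idr.
by exists (h \ov sqY f); rewrite vcompA hP vcomp_idl.
Qed.

(** An epimorphism P_G -> K has zero cokernel, and its cokernel is represented
    by the morphism X + G -> Y, where K is X -> Y; this morphism is then split. *)
Lemma pepi_split (j : obj C) (G : mor1 i j) (K : pobj (i := i) j)
    (p : psquare (pproj G) K) : pepi p ->
  exists (a : hom2 (pY K) (pX K)) (r : hom2 (pY K) G),
    id2 (pY K) = Defs.pmap K \ov a + sqY p \ov r.
Proof.
move=> epi_p.
have [S [sX [sG [qX [qG [psX psG psXG psGX _]]]]]] := biproduct_ex (pX K) G.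
(* T is the cokernel of p; the canonical map K -> T, like the zero map, vanishes
   on P_G, so the two agree, and the homotopy between them is the splitting. *)
pose T := @PObj _ _ i j S (pY K) (Defs.pmap K \ov qX + sqY p \ov qG).
have uP : id2 (pY K) \ov Defs.pmap K = Defs.pmap T \ov sX.
  rewrite vcomp_idl /= vcompDl -!vcompA psX psGX.
  by rewrite vcomp_idr vcomp0r addr0.
have vP : 0 \ov Defs.pmap K = Defs.pmap T \ov (0 : hom2 _ S).
  by rewrite vcomp0l vcomp0r.
have [|h] := epi_p T (@PSquare k C i j K T _ _ uP) (@PSquare k C i j K T _ _ vP).
  exists sG; rewrite /= vcomp_idl vcomp0l subr0 vcompDl -!vcompA psG psXG.
  by rewrite vcomp_idr vcomp0r add0r.
rewrite /= subr0 vcompDl -!vcompA => ->.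
by exists (qX \ov h), (qG \ov h).
Qed.

Lemma pmap_pproj (j : obj C) (G : mor1 i j) (A : pobj (i := i) j)
    (f : psquare A (pproj G)) : sqY f \ov Defs.pmap A = 0.
Proof. by rewrite sq_comm vcomp0l. Qed.

Lemma from_pproj_comm {j : obj C} {G : mor1 i j} {A : pobj (i := i) j}
    (a : hom2 G (pY A)) :
  a \ov Defs.pmap (pproj G) = Defs.pmap A \ov 0.
Proof. by rewrite !vcomp0r. Qed.

Definition from_pproj {j : obj C} {G : mor1 i j} (A : pobj (i := i) j)
    (a : hom2 G (pY A)) : psquare (pproj G) A :=
  @PSquare k C i j (pproj G) A 0 a (from_pproj_comm a).

End Abelianization.

(** * Good 1-morphisms *)

Section Good.
Context {k : fieldType} {C : finitary2cat k} {i : obj C}.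
Context (L : forall j : obj C, mor1 i j -> Prop).

(** The object phi : G -> 1 is the cokernel of P_G -> P_1. *)
Lemma good_viaE (G : mor1 i i) (phi : hom2 G (id1 i)) :
  good_via L phi <->
  forall (j : obj C) (F : mor1 i j), L j F -> pzero (paction F (PObj phi)).
Proof.
split=> goodG j F LF.
  have [xi xiP] := goodG j F LF.
  apply/pzero_split; exists (xi \ov eq2 (comp1_idr F)) => /=.
  have xiE : (id2 F \oh phi) \ov xi = eq2 (esym (comp1_idr F)).
    rewrite -[LHS]vcomp_idl -(eq2_Ksym (comp1_idr F)) -vcompA.
    by rewrite (vcompA (eq2 (comp1_idr F))) xiP vcomp_idr.
  by rewrite vcompA xiE eq2_Ksym.
have /pzero_split [h hP] := goodG j F LF.
exists (h \ov eq2 (esym (comp1_idr F))).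
by rewrite -vcompA (vcompA (id2 F \oh phi)) hP vcomp_idl eq2_symK.
Qed.

(** The image of P_G -> P_1, with its epimorphism from P_G and its cokernel,
    the object phi. *)
Lemma good_duflo (G : mor1 i i) (phi : hom2 G (id1 i)) :
  L i G -> good_via L phi -> duflo L G.
Proof.
move=> LG /good_viaE goodG; split=> //.
have [X [x [x0 xker]]] := weak_kernel phi.
pose K := @PObj _ _ i i X G x.
have mP : phi \ov Defs.pmap K = Defs.pmap (pproj (id1 i)) \ov (0 : hom2 X _).
  by rewrite /= x0 vcomp0r.
pose m := @PSquare k C i i K (pproj (id1 i)) 0 phi mP.
pose q := from_pproj (PObj phi) (id2 (id1 i)).
pose p := from_pproj K (id2 G).
exists K, m; split.
(* The inclusion of X -> G into P_1 is monic because X -> G is a weak kernel of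
   phi. *)
- move=> T u v [h /= uvP].
  have [|h' uvE] := xker _ (sqY u - sqY v); last by exists h'.
  by rewrite vcompBr uvP vcomp0l.
- exists (PObj phi), q; split; last exact: goodG.
  split; first by exists (id2 G); rewrite /= vcomp_idl vcomp_idr.
  move=> T t [h /= tphi]; split.
    exists (@PSquare _ _ _ _ (PObj phi) T h (sqY t) tphi).
    by exists 0; rewrite /= vcomp_idr subrr vcomp0r.
  move=> u v [hu]; rewrite /= vcomp_idr => /eqP; rewrite subr_eq => /eqP uE.
  move=> [hv]; rewrite /= vcomp_idr => /eqP; rewrite subr_eq => /eqP vE.
  exists (hu - hv).
  by rewrite uE vE opprD addrACA subrr addr0 vcompBr.
by exists p => T u v [h]; rewrite /= !vcomp_idr => uvP; exists h.
Qed.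

(** The quotient P_1 / K and the cokernel of P_G -> K -> P_1 coincide.  It is
    enough to compare them in one direction: a map u from the quotient Q = P_1 / K
    to the cokernel, compatible with the maps from P_1, carries the contraction
    of F Q to one of F applied to the cokernel. *)
Lemma duflo_good (G : mor1 i i) :
  duflo L G -> exists phi : hom2 G (id1 i), good_via L phi.
Proof.
case=> LG [K [m [_ [Q [q [[_ cokerQ] killQ]]] [p epi_p]]]].
pose phi := sqY m \ov sqY p.
exists phi; apply/good_viaE => j F LF.
have [a [r idK]] := pepi_split _ _ _ _ epi_p.
pose t := from_pproj (PObj phi) (id2 (id1 i)).
(* K -> P_1 followed by t is null: modulo X -> Y, the identity of the component Y
   of K factors through p, so m factors through phi. *)
have [|[u [s us]] _] := cokerQ (PObj phi) t.
  exists r; rewrite /= vcomp_idl -[LHS]vcomp_idr idK vcompDr !vcompA.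
  by rewrite pmap_pproj vcomp0l add0r.
have /pzero_split [h hP] := killQ j F LF.
apply/pzero_split.
(* Modulo F phi o F s, the identity of F is F(u q); inserting the contraction h
   of F Q between F q and F u makes it factor through F phi. *)
exists ((id2 F \oh sqX u) \ov h \ov (id2 F \oh sqY q) - (id2 F \oh s)) => /=.
have id1E : id2 (id1 i) = sqY u \ov sqY q - phi \ov s.
  by rewrite -us /= opprB addrC subrK.
rewrite vcompBr !vcompA -[in LHS]whisker_vcomp.
have /= <- := sq_comm u.
rewrite whisker_vcomp -(vcompA _ _ h) hP vcomp_idr -!whisker_vcomp.
by rewrite -hcomp_id id1E whiskerB.
Qed.

End Good.

(** With xi a section of G phi', the factorization is
    phi = phi o G phi' o xi = phi' o phi G' o xi. *)
Lemma good_factors {k : fieldType} {C : finitary2cat k} {i : obj C}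
    (L : forall j : obj C, mor1 i j -> Prop) (G G' : mor1 i i)
    (phi : hom2 G (id1 i)) (phi' : hom2 G' (id1 i)) :
  L i G -> good_via L phi' -> exists beta : hom2 G G', phi = phi' \ov beta.
Proof.
move=> LG good'; have [xi xiP] := good' i G LG.
exists (eq2 (comp1_idl G') \ov (phi \oh id2 G') \ov xi).
(* The two unit laws identify 1 o 1 with 1 by a priori different equality
   proofs. *)
have idlr : comp1_idl (id1 i) = comp1_idr (id1 i) by apply: proof_irrelevance.
rewrite !vcompA -hcomp_idl idlr -(vcompA _ _ (phi \oh _)).
rewrite -Defs.interchange vcomp_idl vcomp_idr.
rewrite -[X in X \oh _](vcomp_idr phi) -[X in _ \oh X](vcomp_idl phi').
rewrite Defs.interchange vcompA hcomp_idr.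
by rewrite -!(vcompA phi) xiP vcomp_idr.
Qed.

Theorem proposition13 (k : closedFieldType) (char0 : [pchar k] =i pred0)
    (C : finitary2cat k) (fiatC : fiat C)
    (i : obj C) (L : forall j : obj C, mor1 i j -> Prop) (cellL : left_cell L)
    (G : mor1 i i) (LG : L i G) :
  great L G <-> duflo L G.
Proof.
split=> [[phi [good_phi _]]|/duflo_good [phi good_phi]].
  exact: good_duflo good_phi.
exists phi; split=> // G' phi' good'.
exact: good_factors good'.
Qed.
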